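(* Let $\mathcal{T}$ be a robust tangle of order $k$ in a connectivity system $(E,\lambda)$, and let $\mathcal{S}$ be a tree compatible set. If $\Phi$ is an $\mathcal{S}$-tight $\mathcal{S}$-maximal $k$-flower in $\mathcal{T}$, then every $(k,\mathcal{S})$-separation conforms with $\Phi$.
   Context: A connectivity system is a pair $(E,\lambda)$ with $E$ finite and $\lambda$ integer-valued, symmetric ($\lambda(X)=\lambda(E-X)$) and submodular on subsets of $E$. $X$ is $k$-separating if $\lambda(X)\le k$; a $k$-separation is an unordered partition $(X,E-X)$ with $\lambda(X)\le k$. A robust tangle of order $k$ is a collection $\mathcal T$ of subsets of $E$ with (T1) $\lambda(A)<k$ for $A\in\mathcal T$; (T2) if $\lambda(A)\le k-1$ then $A\in\mathcal T$ or $E-A\in\mathcal T$; (RT3) no eight members of $\mathcal T$ have union $E$; (T4) $E-\{e\}\notin\mathcal T$ for $e\in E$. A set is $\mathcal T$-weak if contained in a member of $\mathcal T$, otherwise $\mathcal T$-strong; a partition/$k$-separation is $\mathcal T$-strong if all parts are. A $\mathcal T$-strong $k$-separating $X$ is fully closed if $X\cup Y$ is not $k$-separating for all nonempty $\mathcal T$-weak $Y\subseteq E-X$; $\mathrm{fcl}_{\mathcal T}(X)$ is the intersection of all fully closed $k$-separating sets containing $X$. $\mathcal T$-strong $k$-separations $(X,Y),(X',Y')$ are $\mathcal T$-equivalent if $\{\mathrm{fcl}_{\mathcal T}(X),\mathrm{fcl}_{\mathcal T}(Y)\}=\{\mathrm{fcl}_{\mathcal T}(X'),\mathrm{fcl}_{\mathcal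 T}(Y')\}$. A $k$-separating $X$ is $\mathcal T$-sequential if $E-X$ is $\mathcal T$-strong and $\mathrm{fcl}_{\mathcal T}(E-X)=E$. Let $\mathcal S$ be a set of non-$\mathcal T$-sequential $k$-separating sets with $\mathcal T$-strong complements; a $(k,\mathcal S)$-separation is a $k$-separation $(X,E-X)$ with $X,E-X\in\mathcal S$. $\mathcal S$ is tree compatible if (S1) any $\mathcal T$-strong $k$-separation $\mathcal T$-equivalent to a $(k,\mathcal S)$-separation is a $(k,\mathcal S)$-separation and (S2) if $X\in\mathcal S$ and $(Y,E-Y)$ is a $\mathcal T$-strong $k$-separation with $X\subseteq Y$ then $Y\in\mathcal S$. A $k$-flower in $\mathcal T$ is a $\mathcal T$-strong partition $(P_1,\dots,P_n)$ of $E$ with $P_i$ and $P_i\cup P_{i+1}$ $k$-separating for all $i$ (indices mod $n$); it displays $(X,E-X)$ if $X$ is a union of petals. $\Phi_1\preccurlyeq_{\mathcal S}\Phi_2$ if every $(k,\mathcal S)$-separation displayed by $\Phi_1$ is $\mathcal T$-equivalent to some $(k,\mathcal S)$-separation displayed by $\Phi_2$; they are equivalent if both hold. $\Phi$ is $\mathcal S$-tight if it is not equivalent to a $k$-flower with fewer petals, and $\mathcal S$-maximal if $\Phi\preccurlyeq_{\mathcal S}\Phi'$ implies $\Phi'\preccurlyeq_{\mathcal S}\Phi$. A $\mathcal T$-strong $k$-separation $(R,G)$ conforms with $\Phi$ if it is $\mathcal T$-equivalent to a $k$-separation displayed by $\Phi$, or to a $k$-separation $(R',G')$ with $R'$ or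 $G'$ contained in a petal of $\Phi$. *)

(* Defs.v *)
From mathcomp Require Import all_boot all_order all_algebra.
Set Implicit Arguments. Unset Strict Implicit. Unset Printing Implicit Defensive.
Import Order.TTheory GRing.Theory Num.Theory.
Local Open Scope ring_scope.

Section Defs.
Variable E : finType.
Variable lam : {set E} -> int.
Variable k : int.
Variable T : {set {set E}}.

Definition connectivity_system : Prop :=
  (forall X : {set E}, lam X = lam (~: X)) /\
  (forall X Y : {set E}, lam (X :|: Y) + lam (X :&: Y) <= lam X + lam Y).

Definition k_separating (X : {set E}) : bool := lam X <= k.

Definition robust_tangle : Prop :=
  [/\ (forall A, A \in T -> lam A < k),
      (forall A : {set E}, lam A <= k - 1 -> (A \in T) \/ (~: A \in T)),
      (forall f : 'I_8 -> {set E},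
          (forall i, f i \in T) -> \bigcup_(i < 8) f i != setT)
    & (forall e : E, ~: [set e] \notin T)].

Definition weak (Y : {set E}) : bool := [exists A in T, Y \subset A].
Definition strong (Y : {set E}) : bool := ~~ weak Y.

Definition fully_closed (X : {set E}) : bool :=
  [&& strong X, k_separating X &
      [forall Y : {set E},
         ((Y != set0) && weak Y && (Y \subset ~: X)) ==> ~~ k_separating (X :|: Y)]].

Definition fcl (X : {set E}) : {set E} :=
  \bigcap_(Z : {set E} | fully_closed Z && (X \subset Z)) Z.

Definition strong_ksep (X : {set E}) : bool :=
  [&& k_separating X, strong X & strong (~: X)].

Definition T_equiv (X X' : {set E}) : Prop :=
  [/\ strong_ksep X, strong_ksep X' &
      (fcl X = fcl X' /\ fcl (~: X) = fcl (~: X')) \/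
      (fcl X = fcl (~: X') /\ fcl (~: X) = fcl X')].

Definition T_sequential (X : {set E}) : Prop :=
  [/\ k_separating X, strong (~: X) & fcl (~: X) = setT].

Variable S : {set {set E}}.

Definition admissible_S : Prop :=
  forall X, X \in S -> [/\ k_separating X, strong (~: X) & ~ T_sequential X].

Definition kS_sep (X : {set E}) : Prop :=
  [/\ k_separating X, X \in S & ~: X \in S].

Definition tree_compatible : Prop :=
  (forall X X', kS_sep X -> T_equiv X X' -> kS_sep X') /\
  (forall X Y, X \in S -> strong_ksep Y -> X \subset Y -> Y \in S).

(* k-flowers are represented by the sequence of petals (P_1, ..., P_n),
   indices taken mod n *)
Definition petal (Phi : seq {set E}) (i : nat) : {set E} := nth set0 Phi i.

Definition k_flower (Phi : seq {set E}) : Prop :=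
  let n := size Phi in
  [/\
      \bigcup_(i < n) petal Phi i = setT,
      (forall i j : nat, (i < n)%N -> (j < n)%N -> i != j ->
         [disjoint petal Phi i & petal Phi j]),
      (forall i : nat, (i < n)%N -> petal Phi i != set0),
      (forall i : nat, (i < n)%N -> strong (petal Phi i)) &
      (forall i : nat, (i < n)%N ->
         k_separating (petal Phi i) /\
         k_separating (petal Phi i :|: petal Phi ((i.+1) %% n)%N))].

Definition displays (Phi : seq {set E}) (X : {set E}) : Prop :=
  exists b : nat -> bool, X = \bigcup_(i < size Phi | b i) petal Phi i.

Definition flower_le (Phi1 Phi2 : seq {set E}) : Prop :=
  forall X, kS_sep X -> displays Phi1 X ->
    exists X', [/\ kS_sep X', displays Phi2 X' & T_equiv X X'].

Definition flower_equiv (Phi1 Phi2 : seq {set E}) : Prop :=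
  flower_le Phi1 Phi2 /\ flower_le Phi2 Phi1.

Definition S_tight (Phi : seq {set E}) : Prop :=
  ~ exists Phi', [/\ k_flower Phi', (size Phi' < size Phi)%N & flower_equiv Phi Phi'].

Definition S_maximal (Phi : seq {set E}) : Prop :=
  forall Phi', k_flower Phi' -> flower_le Phi Phi' -> flower_le Phi' Phi.

Definition conforms (Phi : seq {set E}) (R : {set E}) : Prop :=
  strong_ksep R /\
  exists R', T_equiv R R' /\
    (displays Phi R' \/
     exists i, (i < size Phi)%N /\
       (R' \subset petal Phi i \/ ~: R' \subset petal Phi i)).

End Defs.

(* Main.v *)
(** Replace [R] by an equivalent separation that crosses as few petals as
possible.  If a connected arc of petals meets [R] in a strong set and [~: R] in
a weak one, uncrossing moves the weak part over, so by minimality it is empty;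
hence a crossed petal is cut by [R] into two strong or into two weak parts.

A petal cut into two weak parts contradicts tightness.  By tightness it cannot
be absorbed by a neighbouring petal, and uncrossing then shows that, for every
division of the remaining petals into two arcs, one of the arcs is itself cut
into two weak sets.  So the flower is a single petal [Q] cut into two strong
parts, surrounded by at most three weakly cut arcs (eight weak sets cannot
cover [E]); every displayed non-sequential separation is then equivalent to
[Q], and the two-petal flower [(Q, ~: Q)] does the work of the whole flower.

So all crossed petals are cut into two strong parts.  They can be split one
after the other, keeping a flower, unless [R] or [~: R] lies in a petal.  The
refined flower displays [R], and maximality transfers this to the original
flower. *)
Require Import Defs.
From mathcomp Require Import all_boot all_order all_algebra.
From mathcomp Require Import zify.
Set Implicit Arguments.
Unset Strict Implicit.
Unset Printing Implicit Defensive.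
Import Order.TTheory GRing.Theory Num.Theory.

Ltac instantiate_at x :=
  repeat match goal with
  | H : is_true (?A \subset ?B) |- _ => move/subsetP/(_ x)/implyP: H
  | H : ?A = ?B |- _ => move/setP/(_ x): H
  end.

Ltac set_decide :=
  let x := fresh "x" in
  match goal with
  | |- is_true (_ \subset _) => apply/subsetP => x; apply/implyP
  | |- _ = _ => apply/setP => x
  end;
  instantiate_at x; rewrite ?inE;
  repeat match goal with
  | |- context [x \in ?A] => case: (x \in A); rewrite //=
  end; by [].

Section Tangle.
Variable E : finType.
Variable lam : {set E} -> int.
Variable k : int.
Variable T : {set {set E}}.
Hypothesis lamP : connectivity_system lam.
Hypothesis tangleT : robust_tangle lam k T.

Implicit Types A B V W X Y Z P Q R : {set E}.
Local Notation ks := (k_separating lam k).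
Local Notation weak := (weak T).
Local Notation strong := (strong T).
Local Notation fcl := (fcl lam k T).
Local Notation strong_ksep := (strong_ksep lam k T).

(** * Weak and strong sets, and uncrossing of separating sets *)

Lemma weakS A B : A \subset B -> weak B -> weak A.
Proof.
move=> sAB /existsP[C /andP[CT sBC]]; apply/existsP; exists C.
by rewrite CT (subset_trans sAB).
Qed.

Lemma strongS A B : A \subset B -> strong A -> strong B.
Proof. by move=> sAB; apply: contra; apply: weakS. Qed.

Lemma weak0 A : weak A -> weak set0.
Proof. by apply: weakS; apply: sub0set. Qed.

Lemma ksC X : ks (~: X) = ks X.
Proof. by case: lamP => symm _; rewrite /k_separating -symm. Qed.

Lemma ks_setT X : ks X -> ks setT.
Proof.
case: lamP => symm submod; rewrite /k_separating => kX.
have := submod X (~: X); rewrite setUCr setICr -(setCT E) -!symm => h; lia.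
Qed.

Lemma lam_strong X : strong X -> strong (~: X) -> (k <= lam X)%R.
Proof.
case: tangleT => _ T2 _ _ sX sCX.
case: (lerP k (lam X)) => // lt_lam.
have [|XT|XT] := T2 X; first by lia.
  by case/negP: sX; apply/existsP; exists X; rewrite XT /=.
by case/negP: sCX; apply/existsP; exists (~: X); rewrite XT /=.
Qed.

(** Uncrossing: [X :&: Y] is strong and its complement contains the strong set [~: X], so its
    connectivity is at least [k], and submodularity leaves at most [k] for the union. *)
Lemma ksU X Y : ks X -> ks Y -> strong (X :&: Y) -> strong (~: X) -> ks (X :|: Y).
Proof.
case: (lamP) => _ submod kX kY sI sC.
have := submod X Y.
have : (k <= lam (X :&: Y))%R.
  by apply: lam_strong => //; apply: strongS sC; set_decide.
move: kX kY; rewrite /k_separating; lia.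
Qed.

Lemma ksI X Y : ks X -> ks Y -> strong X -> strong (~: (X :|: Y)) -> ks (X :&: Y).
Proof.
move=> kX kY sX sC; rewrite -ksC setCI; apply: ksU; rewrite ?ksC ?setCK //.
by rewrite -setCU.
Qed.

Lemma weak_cover (ws : seq {set E}) :
  (0 < size ws <= 8)%N -> all weak ws -> \bigcup_(W <- ws) W != setT.
Proof.
case: tangleT => _ _ RT3 _ /andP[ws0 ws8] /allP wws.
(* Positions past the end of [ws] are filled with its head [W0], which is weak; hence every [f i] is
   a member of [T], and the default [set0] of [odflt] never occurs. *)
set W0 := head set0 ws.
pose f (i : 'I_8) := odflt set0 [pick A in T | nth W0 ws i \subset A].
have fP i : (f i \in T) && (nth W0 ws i \subset f i).
  rewrite /f; case: pickP => //= noA.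
  have /existsP[A] : weak (nth W0 ws i).
    apply: wws; case: (ltnP i (size ws)) => [/mem_nth-> // | le_i].
    by rewrite nth_default // /W0; case: (ws) ws0 => //= *; rewrite mem_head.
  by move=> hA; have := noA A; rewrite /= hA.
apply: contra (RT3 f (fun i => proj1 (andP (fP i)))) => /eqP cov.
rewrite -subTset -cov (big_nth W0) big_mkord; apply/bigcupsP => /= i _.
have /andP[_ s_i] := fP (widen_ord ws8 i).
exact: subset_trans s_i (bigcup_sup (widen_ord ws8 i) _).
Qed.

(** * Full closure and equivalence of separations *)

Lemma sub_fcl X : X \subset fcl X.
Proof. by apply/bigcapsP => Z /andP[]. Qed.

Lemma fcl_sub X Z : fully_closed lam k T Z && (X \subset Z) -> fcl X \subset Z.
Proof. by move=> fcZ; apply: bigcap_inf. Qed.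

Lemma fclS X Y : X \subset Y -> fcl X \subset fcl Y.
Proof.
move=> sXY; apply/bigcapsP => Z /andP[fcZ sYZ]; apply: fcl_sub.
by rewrite fcZ (subset_trans sXY).
Qed.

Lemma fcl_between X Y : X \subset Y -> Y \subset fcl X -> fcl Y = fcl X.
Proof.
move=> sXY sYf; apply/eqP; rewrite eqEsubset (fclS sXY) andbT.
apply/bigcapsP => Z fcZ; apply: fcl_sub.
by rewrite (subset_trans sYf (fcl_sub fcZ)) andbT; case/andP: fcZ.
Qed.

(* [Z] runs over the fully closed sets containing [X]: uncrossing [B] with [Z]
   shows that [Z :|: B] is [k]-separating, unless [~: Z] is weak and [Z] is all of [E]. *)
Lemma fcl_absorb X A B :
  strong A -> ks B -> weak (B :\: A) -> A \subset B -> A \subset fcl X -> B \subset fcl X.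
Proof.
move=> sA kB wBA sAB sAX; apply/bigcapsP => Z fcXZ.
have {}sAZ : A \subset Z by exact: subset_trans sAX (fcl_sub fcXZ).
have /andP[/and3P[_ kZ /forallP nZ] _] := fcXZ.
have full Y : Y :&: Z = set0 -> weak Y -> ks (Z :|: Y) -> Y = set0.
  move=> dYZ wY kZY; apply/eqP; have := nZ Y; rewrite kZY implybF wY /=.
  have -> : Y \subset ~: Z by set_decide.
  by rewrite !andbT negbK.
have [wC|sC] := boolP (weak (~: Z)).
  have C0 : ~: Z = set0.
    apply: full => //; first by rewrite setIC setICr.
    by rewrite setUCr (ks_setT kZ).
  by set_decide.
have D0 : B :\: Z = set0.
  apply: full; first by set_decide.
    by apply: weakS wBA; set_decide.
  have -> : Z :|: B :\: Z = Z :|: B by set_decide.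
  by apply: ksU => //; apply: strongS sA; set_decide.
by set_decide.
Qed.

(** What a [(k, S)]-separation satisfies independently of [S]: both sides are strong and neither is
    [T_sequential]. *)
Definition nonseq X := strong_ksep X && (fcl X != setT) && (fcl (~: X) != setT).

(* [T_equiv] with the two sides matched in order. *)
Definition same_fcl X Y :=
  [&& strong_ksep X, strong_ksep Y, fcl X == fcl Y & fcl (~: X) == fcl (~: Y)].

Lemma strong_ksepC X : strong_ksep (~: X) = strong_ksep X.
Proof. by rewrite /Defs.strong_ksep ksC setCK; congr (_ && _); rewrite andbC. Qed.

Lemma nonseqC X : nonseq (~: X) = nonseq X.
Proof. by rewrite /nonseq strong_ksepC setCK -!andbA (andbC (fcl X != _)). Qed.

Lemma same_fclC X Y : same_fcl (~: X) (~: Y) = same_fcl X Y.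
Proof. by rewrite /same_fcl !strong_ksepC !setCK (andbC (fcl X == _)). Qed.

Lemma same_fcl_refl X : strong_ksep X -> same_fcl X X.
Proof. by rewrite /same_fcl !eqxx => ->. Qed.

Lemma same_fcl_trans Y X Z : same_fcl X Y -> same_fcl Y Z -> same_fcl X Z.
Proof.
case/and4P=> sX _ /eqP e1 /eqP e2 /and4P[_ sZ /eqP e3 /eqP e4].
by apply/and4P; rewrite e1 e2 e3 e4.
Qed.

Lemma same_fcl_nonseq X Y : same_fcl X Y -> nonseq X -> nonseq Y.
Proof.
by rewrite /nonseq; case/and4P=> _ -> /eqP-> /eqP->; rewrite -andbA => /andP[].
Qed.

(** [Y] lies in the closure of [X], and [~: X] in that of [~: Y], because each arises by adding a
    weak set. The side [~: Y] is strong, since otherwise it too would be absorbed and [fcl X] would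
    be all of [E]. *)
Lemma same_fcl_step X Y : nonseq X -> X \subset Y -> ks Y -> weak (Y :\: X) -> same_fcl X Y.
Proof.
case/andP=> /andP[skX nX _] sXY kY wYX; have /and3P[kX sX sCX] := skX.
have sY : strong Y by apply: strongS sX.
have sYf : Y \subset fcl X by apply: fcl_absorb (sub_fcl X).
have sCY : strong (~: Y).
  apply: contra nX => wCY; rewrite -subTset.
  apply: fcl_absorb sYf; rewrite ?subsetT ?setTD //; exact: ks_setT kX.
rewrite /same_fcl skX /Defs.strong_ksep kY sY sCY (fcl_between sXY sYf) eqxx /=.
rewrite (@fcl_between (~: Y) (~: X)) ?eqxx ?setCS //.
apply: fcl_absorb (sub_fcl _); rewrite ?ksC ?setCS //.
by apply: weakS wYX; set_decide.
Qed.

Lemma same_fcl_step2 X Y Z : nonseq X -> X \subset Y -> Y \subset Z -> ks Y -> ks Z ->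
  weak (Y :\: X) -> weak (Z :\: Y) -> same_fcl X Z.
Proof.
move=> nX sXY sYZ kY kZ wYX wZY; have eXY := same_fcl_step nX sXY kY wYX.
by apply: (same_fcl_trans eXY); apply: same_fcl_step => //; apply: same_fcl_nonseq eXY nX.
Qed.

Lemma nonseq_step_strongC X Y :
  nonseq X -> X \subset Y -> ks Y -> weak (Y :\: X) -> strong (~: Y).
Proof. by move=> nX sXY kY /(same_fcl_step nX sXY kY)/and4P[_ /and3P[]]. Qed.

(** * Flowers as cyclic lists of petals *)

Definition ks2 P Q := ks (P :|: Q).
Local Notation U s := (\bigcup_(P <- s) P).

(* Unlike [k_flower], this form is visibly invariant under rotation of the list of petals. *)
Definition flower (s : seq {set E}) : Prop :=
  [/\ U s = setT, uniq s,
      {in s &, forall P Q, P != Q -> P :&: Q = set0},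
      {in s, forall P, [/\ P != set0, strong P & ks P]} & cycle ks2 s].

Implicit Types s C D : seq {set E}.

Lemma sub_U P s : P \in s -> P \subset U s.
Proof. by move=> Ps; rewrite (big_rem P) //= subsetUl. Qed.

Lemma mem_U s x : x \in U s -> exists2 P, P \in s & x \in P.
Proof. by rewrite bigcup_seq => /bigcupP. Qed.

Lemma flower_catC C D : flower (C ++ D) -> flower (D ++ C).
Proof.
case=> cov un dis pet cyc.
have mDC : D ++ C =i C ++ D by move=> P; rewrite !mem_cat orbC.
split; first by rewrite big_cat /= setUC -cov big_cat.
- by rewrite uniq_catC.
- by move=> P Q; rewrite !mDC; apply: dis.
- by move=> P; rewrite mDC; apply: pet.
- by rewrite -rot_size_cat rot_cycle.
Qed.

Lemma flower_UC C D : flower (C ++ D) -> U D = ~: U C.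
Proof.
case=> cov un dis _ _.
have d0 : U C :&: U D = set0.
  apply/eqP; rewrite -subset0; apply/subsetP => x /setIP[].
  case/mem_U => P PC xP /mem_U[Q QD xQ].
  have nPQ : P != Q.
    apply/eqP => ePQ; move: un; rewrite cat_uniq => /and3P[_ /hasPn/(_ Q QD)].
    by rewrite /= -ePQ PC.
  by rewrite -(dis P Q) ?mem_cat ?PC ?QD ?orbT //; apply/setIP.
move: cov; rewrite big_cat /= => cov; set_decide.
Qed.

Lemma flower_petal s P : flower s -> P \in s -> [/\ P != set0, strong P & ks P].
Proof. by case=> _ _ _ pet _; apply: pet. Qed.

Lemma flower_strong s P : flower s -> P \in s -> strong P.
Proof. by move=> fs /(flower_petal fs)[]. Qed.

(** A further petal [Q] is added by uncrossing the arc with the union of its last petal and [Q]: the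
    overlap contains that last petal, and [Q] lies outside the arc. *)
Lemma flower_ks C D : flower (C ++ D) -> C != [::] -> ks (U C).
Proof.
case: C => //= P C + _; elim/last_ind: C D => [|C Q IH] D fl.
  by rewrite big_seq1; case: (flower_petal fl (mem_head _ _)).
rewrite cat_rcons in fl.
have pQ : Q \in P :: C ++ Q :: D by rewrite inE mem_cat mem_head !orbT.
have pL : last P C \in P :: C ++ Q :: D.
  by rewrite -cat_cons mem_cat mem_last.
have kL : ks (last P C :|: Q).
  case: fl => _ _ _ _ /=; rewrite rcons_cat cat_path /= => /and3P[_].
  by [].
have sL : last P C \subset U (P :: C) by apply/sub_U/mem_last.
have compl := flower_UC (C := P :: C) (D := Q :: D) fl.
have sQ : Q \subset U (Q :: D) by apply/sub_U/mem_head.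
have -> : U (P :: rcons C Q) = U (P :: C) :|: (last P C :|: Q).
  rewrite -rcons_cons -cats1 big_cat big_seq1 /=; set_decide.
apply: ksU => //; first exact: IH fl.
  by apply: strongS (flower_strong fl pL); set_decide.
by apply: strongS (flower_strong fl pQ); rewrite -compl.
Qed.

Lemma flower_ksr C D : flower (C ++ D) -> D != [::] -> ks (U D).
Proof. by move/flower_catC; apply: flower_ks. Qed.

Lemma flower_strongU s C : flower s -> {subset C <= s} -> C != [::] -> strong (U C).
Proof.
case: C => // P C fs sC _; apply: strongS (flower_strong fs (sC P _)).
  by apply/sub_U/mem_head.
exact: mem_head.
Qed.

Lemma flower_merge C D : flower (C ++ D) -> C != [::] -> flower (U C :: D).
Proof.
move=> fl nC; have kC := flower_ks fl nC.
have sC : strong (U C).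
  by apply: flower_strongU fl _ nC => P PC; rewrite mem_cat PC.
have fD P : P \in D -> P \in C ++ D by move=> PD; rewrite mem_cat PD orbT.
have [P0 P0C] : exists P, P \in C by case: (C) nC => // P *; exists P; rewrite mem_head.
have n0 : U C != set0.
  have /(flower_petal fl)[/set0Pn[x xP] _ _] : P0 \in C ++ D by rewrite mem_cat P0C.
  by apply/set0Pn; exists x; apply: (subsetP (sub_U P0C)).
have compl := flower_UC fl.
have dis P : P \in D -> U C :&: P = set0 by move/sub_U; rewrite compl => sP; set_decide.
have UCD : U C \notin D.
  by apply/negP => /dis; rewrite setIid => /eqP; rewrite (negPf n0).
case: (fl) => cov un disj pet cyc; split.
- by rewrite big_cons -big_cat.
- by rewrite /= UCD; move: un; rewrite cat_uniq => /and3P[].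
- move=> P Q; rewrite !inE => /predU1P[->|PD] /predU1P[->|QD]; rewrite ?eqxx // => nPQ.
  + exact: dis.
  + by rewrite setIC dis.
  + by apply: disj; rewrite ?fD.
- move=> P; rewrite inE => /predU1P[->|PD] //; exact/pet/fD.
case: D fl cyc {fD compl dis UCD cov un disj pet} => [|d D] fl cyc.
  by rewrite /= /ks2 setUid kC.
have k1 : ks2 (U C) d.
  move: fl; rewrite -cat_rcons => /flower_ks; rewrite -cats1 big_cat big_seq1.
  by apply; rewrite -size_eq0 size_cat addn1.
have k2 : ks2 (last d D) (U C).
  move: fl; rewrite lastI -cats1 catA => /flower_catC; rewrite catA => /flower_ks.
  by rewrite big_cons; apply.
case: C nC {fl kC sC n0 P0C} cyc k1 k2 => //= P C _.
rewrite rcons_cat cat_path /= => /and3P[_ _]; rewrite !rcons_path.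
by case/andP=> -> _ -> ->.
Qed.

(** The adjacency of the last petal [L] and [A] comes for free: [L :|: A] is the intersection of
    [L :|: P] with the complement of [B :|: Q], and when [Q] is the only other petal it is the
    complement of [B]. *)
Lemma flower_refine P Q s A B : flower (P :: Q :: s) ->
  A :|: B = P -> A :&: B = set0 -> A != set0 -> B != set0 ->
  strong A -> strong B -> ks A -> ks B -> ks2 B Q -> flower (A :: B :: Q :: s).
Proof.
move=> fl ABP AB0 nA nB sA sB kA kB kBQ.
have pP : P \in P :: Q :: s by rewrite mem_head.
have compl := flower_UC (C := [:: P]) (D := Q :: s) fl.
rewrite big_seq1 in compl.
have sub R : R \in Q :: s -> R \subset ~: P by rewrite -compl; apply: sub_U.
have AR0 R : R \in Q :: s -> A :&: R = set0 by move/sub => sR; set_decide.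
have BR0 R : R \in Q :: s -> B :&: R = set0 by move/sub => sR; set_decide.
have disC X : X != set0 -> (forall R, R \in Q :: s -> X :&: R = set0) -> X \notin Q :: s.
  by move=> nX h; apply/negP => /h; rewrite setIid => /eqP; rewrite (negPf nX).
have nAB : A != B by apply: contraNneq nA => eAB; rewrite -AB0 -eAB setIid.
have kAB : ks2 A B by rewrite /ks2 ABP; case: (flower_petal fl pP).
have kLA : ks2 (last Q s) A.
  have pL : last Q s \in Q :: s by apply: mem_last.
  have [s0|[x xs]] : s = [::] \/ exists x, x \in s.
    by case: (s) => [|x s']; [left | right; exists x; rewrite mem_head].
    rewrite s0 big_seq1 in compl.
    rewrite /ks2 s0 /= -ksC; have -> // : ~: (Q :|: A) = B by set_decide.
  have pLs : last Q s \in s by case: (s) xs => //= y s' _; apply: mem_last.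
  have nLQ : last Q s :&: Q = set0.
    case: fl => _ /and3P[_ nQ _] dis _ _; apply: dis; rewrite ?inE ?pLs ?eqxx ?orbT //.
    by apply: contraNneq nQ => <-.
  have sL := sub _ pL; have sQ := sub Q (mem_head _ _).
  have kLP : ks2 (last Q s) P.
    by case: fl => _ _ _ _ /=; rewrite rcons_path => /and3P[].
  rewrite /ks2; have -> : last Q s :|: A = (last Q s :|: P) :&: ~: (B :|: Q) by set_decide.
  apply: ksI; rewrite ?ksC //.
    by apply: strongS sA; set_decide.
  apply: strongS (flower_strong fl (P := Q) _); first by set_decide.
  by rewrite !inE eqxx orbT.
case: (fl) => cov un dis pet cyc; split.
- by rewrite -cov !big_cons /= -ABP setUA.
- have UA : A \notin B :: Q :: s by rewrite in_cons negb_or nAB disC.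
  have UB : B \notin Q :: s by apply: disC.
  by move: un; rewrite (cons_uniq A) (cons_uniq B) UA UB /= => /andP[].
- move=> X Y; rewrite !(in_cons A) !(in_cons B) => /predU1P[->|/predU1P[->|XR]].
  + move=> /predU1P[->|/predU1P[->|YR]] nXY //; last exact: AR0.
    by rewrite eqxx in nXY.
  + move=> /predU1P[->|/predU1P[->|YR]] nXY; [by rewrite setIC | | exact: BR0].
    by rewrite eqxx in nXY.
  + move=> /predU1P[->|/predU1P[->|YR]] nXY.
    * by rewrite setIC AR0.
    * by rewrite setIC BR0.
    by apply: dis => //; rewrite in_cons ?XR ?YR orbT.
- move=> X; rewrite !(in_cons A) !(in_cons B) => /predU1P[->|/predU1P[->|XR]] //.
  by apply: pet; rewrite in_cons XR orbT.
- move: cyc; rewrite /= !rcons_path => /and3P[_ -> _].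
  by rewrite kAB kBQ.
Qed.

Lemma U_nth s : \bigcup_(i < size s) petal s i = U s.
Proof. by rewrite (big_nth set0) big_mkord. Qed.

Lemma flowerP s : s != [::] -> k_flower lam k T s <-> flower s.
Proof.
move=> ns.
have cycP : cycle ks2 s <->
    forall i, (i < size s)%N -> ks (petal s i :|: petal s (i.+1 %% size s)).
  (* [cycle] on [x :: p] is a path along [rcons p x], whose entry at [i] is the petal of index
     [i + 1] modulo the length. *)
  have E1 p x i : (i < (size p).+1)%N ->
      nth set0 (rcons p x) i = nth set0 (x :: p) (i.+1 %% (size p).+1).
    move=> lt_i; rewrite nth_rcons; case: ltngtP => [lt|lt|->].
    - by rewrite modn_small.
    - by rewrite ltnS leqNgt lt in lt_i.
    - by rewrite modnn.
  have E2 p x i : (i < (size p).+1)%N -> nth set0 (x :: rcons p x) i = nth set0 (x :: p) i.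
    by case: i => // i; rewrite ltnS /= nth_rcons => ->.
  case: s ns => // x p _ /=; split.
    move/(pathP set0) => h i lt_i; have := h i; rewrite size_rcons => /(_ lt_i).
    by rewrite /ks2 E2 // E1.
  move=> h; apply/(pathP set0) => i; rewrite size_rcons => lt_i.
  by rewrite /ks2 E2 // E1 //; apply: h.
split.
  case; rewrite U_nth => cov dis nz st kk.
  have pet P : P \in s -> exists2 i, (i < size s)%N & P = petal s i.
    by move=> Ps; exists (index P s); rewrite ?index_mem // /petal nth_index.
  split=> //.
  - apply/(uniqP set0) => i j lt_i lt_j eq_ij; apply/eqP/negPn/negP => nij.
    have := dis i j lt_i lt_j nij; rewrite /petal eq_ij -setI_eq0 setIid.
    by apply/negP; apply: nz.
  - move=> P Q /pet[i lt_i ->] /pet[j lt_j ->] nPQ.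
    apply/eqP; rewrite setI_eq0; apply: dis => //.
    by apply: contraNneq nPQ => ->.
  - move=> P /pet[i lt_i ->]; split; [exact: nz | exact: st | by case: (kk i lt_i)].
  - by apply/cycP => i lt_i; case: (kk i lt_i).
case=> cov un dis pet cyc; split; rewrite ?U_nth //.
- move=> i j lt_i lt_j nij; rewrite -setI_eq0 dis ?mem_nth //.
  by rewrite /petal nth_uniq.
- by move=> i lt_i; case: (pet _ (mem_nth set0 lt_i)).
- by move=> i lt_i; case: (pet _ (mem_nth set0 lt_i)).
- move=> i lt_i; split; first by case: (pet _ (mem_nth set0 lt_i)).
  by move/cycP: cyc; apply.
Qed.

(** * Displayed separations *)

Definition disp s X := all (fun P => (P \subset X) || (P \subset ~: X)) s.

Lemma dispC s X : disp s (~: X) = disp s X.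
Proof. by apply: eq_all => P; rewrite setCK orbC. Qed.

Lemma dispE s X : flower s -> displays s X <-> disp s X.
Proof.
move=> fl; have [cov _ dis _ _] := fl; split.
  case=> b ->; apply/(all_nthP set0) => i lt_i; have [bi|nbi] := boolP (b i).
    by rewrite (bigcup_sup (Ordinal lt_i)).
  apply/orP; right; rewrite -setCS setCK; apply/bigcupsP => j bj.
  have nji : val j != i by apply: contraNneq nbi => <-.
  have : petal s j :&: nth set0 s i = set0.
    by apply: dis; rewrite ?mem_nth // nth_uniq //; case: fl.
  by move=> d0; set_decide.
move/(all_nthP set0) => dX; exists (fun i => petal s i \subset X).
apply/eqP; rewrite eqEsubset; apply/andP; split; last by apply/bigcupsP.
apply/subsetP => x xX; have : x \in U s by rewrite cov.
rewrite -U_nth => /bigcupP[i _ xi]; apply/bigcupP; exists i => //.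
case/orP: (dX i (ltn_ord i)) => // /subsetP/(_ x xi).
by rewrite inE xX.
Qed.

Lemma dispS s1 s2 X : {subset s1 <= s2} -> disp s2 X -> disp s1 X.
Proof. by move=> s12 /allP h; apply/allP => P /s12/h. Qed.

Lemma disp_U C D : flower (C ++ D) -> disp (C ++ D) (U C).
Proof.
move=> fl; apply/allP => P; rewrite mem_cat => /orP[/sub_U-> // | /sub_U].
by rewrite (flower_UC fl) => ->; rewrite orbT.
Qed.

Lemma flower_mid C1 C2 C3 : flower (C1 ++ C2 ++ C3) -> C2 != [::] ->
  ks (U C2) /\ disp (C1 ++ C2 ++ C3) (U C2).
Proof.
move/flower_catC; rewrite -catA => fl n2; split; first exact: flower_ks fl n2.
by apply: dispS (disp_U fl) => P; rewrite !mem_cat => /or3P[]->; rewrite ?orbT.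
Qed.

Lemma disp_merge C D X : disp (U C :: D) X -> disp (C ++ D) X.
Proof.
case/andP=> hC hD; rewrite /disp all_cat [all _ D]hD andbT.
by apply/allP => P /sub_U sP; case/orP: hC => /(subset_trans sP)->; rewrite ?orbT.
Qed.

(** * Crossed petals and refinement of a flower *)

Definition crossed R P := ~~ ((P \subset R) || (P \subset ~: R)).
(** Serves both as the measure for splitting petals one at a time and as the quantity minimised over
    the separations equivalent to [R]. *)
Definition ncross s R := #|[set P in s | crossed R P]|.

Lemma ncrossC s R : ncross s (~: R) = ncross s R.
Proof. by rewrite /ncross; apply: eq_card => P; rewrite !inE /crossed setCK orbC. Qed.

Lemma crossed_halves R P : crossed R P -> P :&: R != set0 /\ P :&: ~: R != set0.
Proof.
rewrite /crossed negb_or => /andP[nR nC]; split.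
  by apply: contra nC => /eqP e; set_decide.
by apply: contra nR => /eqP e; set_decide.
Qed.

(** Uncross [~: R] with [Q], then intersect the result with [P :|: Q]; the part outside both is
    [U s :&: R]. *)
Lemma ks_refine P Q s R : flower (P :: Q :: s) -> ks R -> strong R ->
  strong (Q :&: ~: R) -> strong (U s :&: R) -> ks2 (P :&: ~: R) Q.
Proof.
move=> fl kR sR sQ ss.
have kPQ : ks (P :|: Q).
  have := flower_ks (C := [:: P; Q]) (D := s) fl isT.
  by rewrite big_cons big_seq1.
have compl := flower_UC (C := [:: P; Q]) (D := s) fl.
rewrite big_cons big_seq1 /= in compl.
have kQ : ks Q by have [] := flower_petal (P := Q) fl; rewrite // !inE eqxx orbT.
have kQR : ks (~: R :|: Q).
  by apply: ksU; rewrite ?ksC ?setCK // setIC.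
rewrite /ks2; have -> : P :&: ~: R :|: Q = (P :|: Q) :&: (~: R :|: Q) by set_decide.
apply: ksI => //; first by apply: strongS sQ; set_decide.
by apply: strongS ss; set_decide.
Qed.

(** Induction on [ncross]. Since neither side of [R] lies in a petal, the petals other than the
    crossed one meet both sides, and do so in strong sets; this makes both halves of the crossed
    petal [k]-separating. *)
Lemma refine_displaying s R : flower s -> s != [::] -> strong_ksep R ->
  {in s, forall P, P :&: R != set0 -> strong (P :&: R)} ->
  {in s, forall P, P :&: ~: R != set0 -> strong (P :&: ~: R)} ->
  {in s, forall P, ~~ (R \subset P) && ~~ (~: R \subset P)} ->
  exists s', [/\ flower s', s' != [::], forall X, disp s X -> disp s' X & disp s' R].
Proof.
move: {2}(ncross s R).+1 (ltnSn (ncross s R)) => n.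
elim: n s => // n IH s lt_n fl ns skR hR hC hsub.
have [dR|] := boolP (disp s R); first by exists s.
case/allPn => P Ps crP; have /and3P[kR sR sCR] := skR.
case: (rot_to Ps) => i s' Es.
have ms : P :: s' =i s by move=> X; rewrite -Es mem_rot.
have {}fl : flower (P :: s') by rewrite -Es; apply: flower_catC; rewrite cat_take_drop.
have compl := flower_UC (C := [:: P]) (D := s') fl.
rewrite big_seq1 in compl.
have /andP[nRP nCP] := hsub P Ps.
have [P_R P_C] := crossed_halves crP.
have restR : U s' :&: R != set0.
  by apply: contra nRP => /eqP e; set_decide.
have restC : U s' :&: ~: R != set0.
  by apply: contra nCP => /eqP e; set_decide.
case: s' Es ms fl compl restR restC => [|Q t] Es ms fl compl restR restC.
  by rewrite big_nil set0I eqxx in restR.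
have [_ sP kP] := flower_petal fl (mem_head _ _).
have Qs : Q \in s by rewrite -ms !inE eqxx orbT.
have restS Z t' : {subset t' <= s} -> U t' :&: Z != set0 ->
    {in s, forall P, P :&: Z != set0 -> strong (P :&: Z)} -> strong (U t' :&: Z).
  move=> tt n0 h; have /set0Pn[x /setIP[]] := n0.
  case/mem_U => X Xt xX xZ.
  have sXZ : strong (X :&: Z).
    by apply: h (tt _ Xt) _; apply/set0Pn; exists x; apply/setIP.
  have sXU : X \subset U t' by apply: sub_U.
  by apply: strongS sXZ; apply: setSI.
have subQ : {subset Q :: t <= s} by move=> X Xt; rewrite -ms in_cons Xt orbT.
have subQ_fl X : X \in t -> X \in P :: Q :: t.
  by move=> Xt; rewrite !in_cons Xt !orbT.
have subt : {subset t <= s} by move=> X Xt; apply: subQ; rewrite in_cons Xt orbT.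
have sQR := restS R (Q :: t) subQ restR hR.
have sQC := restS (~: R) (Q :: t) subQ restC hC.
have kPR : ks (P :&: R).
  by apply: ksI => //; apply: strongS sQC; rewrite compl; set_decide.
have kPC : ks (P :&: ~: R).
  by apply: ksI; rewrite ?ksC //; apply: strongS sQR; rewrite compl; set_decide.
have nPQ : P != Q.
  by case: (fl) => _ un _ _ _; apply: contraTneq un => ->; rewrite /= mem_head.
have PRR Z : (P :&: Z) :&: Z = P :&: Z by set_decide.
have PCR : (P :&: ~: R) :&: R = set0 by set_decide.
have PRC : (P :&: R) :&: ~: R = set0 by set_decide.
(* Once the halves of [P] fit into the flower in some order, all hypotheses persist and [P] no
   longer counts as crossed, so induction applies. *)
suff [A [B [flAB AB]]] : exists A B, flower (A :: B :: Q :: t) /\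
    (A = P :&: R /\ B = P :&: ~: R \/ A = P :&: ~: R /\ B = P :&: R).
  have sAP : A \subset P by case: AB => -[-> _]; apply: subsetIl.
  have sBP : B \subset P by case: AB => -[_ ->]; apply: subsetIl.
  have cA : crossed R A = false.
    by case: AB => -[-> _]; apply/negbF; rewrite ?subsetIr ?orbT.
  have cB : crossed R B = false.
    by case: AB => -[_ ->]; apply/negbF; rewrite ?subsetIr ?orbT.
  have AorB X : X \in A :: B :: Q :: t ->
      [\/ X = P :&: R, X = P :&: ~: R | X \in Q :: t].
    rewrite (in_cons A) (in_cons B) => /predU1P[->|/predU1P[->|Xt]].
    - by case: AB => -[-> _]; [constructor 1 | constructor 2].
    - by case: AB => -[_ ->]; [constructor 2 | constructor 1].
    - by constructor 3.
  suff [s2 [fl2 ns2 d2 dR2]] : exists s2, [/\ flower s2, s2 != [::],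
      forall X, disp (A :: B :: Q :: t) X -> disp s2 X & disp s2 R].
    exists s2; split=> // X dX; apply: d2; move: dX => /allP dX.
    have dP := dX P Ps.
    apply/allP => Y; rewrite (in_cons A) (in_cons B) => /predU1P[->|/predU1P[->|/subQ/dX//]].
      by case/orP: dP => /(subset_trans sAP)->; rewrite ?orbT.
    by case/orP: dP => /(subset_trans sBP)->; rewrite ?orbT.
  apply: IH => //.
  - rewrite ltnS in lt_n; apply: (leq_trans _ lt_n); apply: proper_card; rewrite properE.
    apply/andP; split.
      apply/subsetP => X; rewrite !in_set (in_cons A) (in_cons B).
      by case/andP=> /predU1P[->|/predU1P[->|/subQ->]]; rewrite ?cA ?cB.
    apply/subsetPn; exists P; first by rewrite in_set Ps.
    rewrite in_set negb_and; apply/orP; left.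
    apply/negP => /AorB[eP|eP|Pt].
    - by move: P_C; rewrite eP PRC eqxx.
    - by move: P_R; rewrite eP PCR eqxx.
    - by case: (fl) => _; rewrite /= -/(P \in Q :: t) Pt.
  - move=> X /AorB[->|->|/subQ Xs]; last exact: hR.
      by rewrite PRR; apply: hR.
    by rewrite PCR eqxx.
  - move=> X /AorB[->|->|/subQ Xs]; last exact: hC.
      by rewrite PRC eqxx.
    by rewrite PRR; apply: hC.
  - move=> X /AorB[->|->|/subQ Xs]; last exact: hsub.
      by rewrite !subsetI !negb_and nRP nCP.
    by rewrite !subsetI !negb_and nRP nCP.
have pieces : P :&: R :|: P :&: ~: R = P by set_decide.
have pieces0 : (P :&: R) :&: (P :&: ~: R) = set0 by set_decide.
have sPR := hR P Ps P_R; have sPC := hC P Ps P_C.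
(* The half to be placed next to [Q] is chosen so that [Q] meets its side of [R] and the later
   petals meet the other side; since [U (Q :: t)] meets both sides, one of the two choices is
   possible. *)
have [kk|kk] : ks2 (P :&: ~: R) Q \/ ks2 (P :&: R) Q.
- have [t0|nt] := eqVneq t [::].
    left; rewrite t0 big_seq1 in compl; rewrite /ks2 -ksC.
    by have -> : ~: (P :&: ~: R :|: Q) = P :&: R by set_decide.
  have case1 : Q :&: ~: R != set0 -> U t :&: R != set0 -> ks2 (P :&: ~: R) Q.
    by move=> n1 n2; apply: ks_refine fl kR sR (hC _ Qs n1) (restS _ _ subt n2 hR).
  have case2 : Q :&: R != set0 -> U t :&: ~: R != set0 -> ks2 (P :&: R) Q.
    move=> n1 n2; rewrite -[R in P :&: R]setCK.
    by apply: ks_refine fl _ sCR _ (restS _ _ subt n2 hC); rewrite ?ksC ?setCK ?hR.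
  have [QC0|nQC] := eqVneq (Q :&: ~: R) set0.
    right; apply: case2.
      by have := flower_petal fl (P := Q); case=> [|nQ _ _]; rewrite ?inE ?eqxx ?orbT //;
         apply: contra nQ => /eqP e; apply/eqP; set_decide.
    by apply: contra restC => /eqP e; rewrite big_cons /= setIUl QC0 e setU0.
  have [QR0|nQR] := eqVneq (Q :&: R) set0.
    left; apply: case1 => //.
    by apply: contra restR => /eqP e; rewrite big_cons /= setIUl QR0 e setU0.
  have [tR0|nR] := eqVneq (U t :&: R) set0; last by left; apply: case1.
  right; apply: case2 => //.
  have /hasP[X Xt _] : has predT t by rewrite has_predT lt0n size_eq0.
  have [nX _ _] := flower_petal fl (P := X) (subQ_fl X Xt).
  have sX := sub_U Xt.
  by apply: contra nX => /eqP e; apply/eqP; set_decide.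
- exists (P :&: R), (P :&: ~: R); split; last by left.
  exact: flower_refine fl _ _ _ _ _ _ _ _ _.
- exists (P :&: ~: R), (P :&: R); split; last by right.
  by apply: flower_refine fl _ _ _ _ _ _ _ _ _; rewrite // (setUC, setIC).
Qed.

(** * Tight flowers and separations crossing fewest petals *)

Variable S : {set {set E}}.
Hypothesis admS : admissible_S lam k T S.
Hypothesis treeS : tree_compatible lam k T S.
Local Notation kS := (kS_sep lam k S).

Lemma kS_C X : kS X -> kS (~: X).
Proof. by case=> kX XS CXS; split; rewrite ?ksC ?setCK. Qed.

Lemma kS_nonseq X : kS X -> nonseq X.
Proof.
move=> [kX XS CXS]; have [_ sCX nX] := admS XS; have [kCX sX nCX] := admS CXS.
rewrite setCK in sX; apply/andP; split; [apply/andP; split|].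
- by apply/and3P.
- by apply/eqP => e; apply: nCX; split; rewrite // setCK.
- by apply/eqP => e; apply: nX; split.
Qed.

Lemma same_fcl_equiv X Y : same_fcl X Y -> T_equiv lam k T X Y.
Proof. by case/and4P=> sX sY /eqP e1 /eqP e2; split=> //; left. Qed.

Lemma same_fcl_kS X Y : kS X -> same_fcl X Y -> kS Y.
Proof. by move=> kX /same_fcl_equiv; apply: (proj1 treeS). Qed.

(* [S_tight] for coarsenings only, where just one direction of the equivalence needs a proof. *)
Definition tight s := forall s', flower s' -> (size s' < size s)%N ->
  (forall X, disp s' X -> disp s X) ->
  ~ (forall X, kS X -> disp s X -> exists2 X', disp s' X' & same_fcl X X').

(** Minimality over [same_fcl] amounts to minimality over [T_equiv], because [ncross] is unchanged
    by complementation. *)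
Definition good s R := [/\ flower s, tight s, nonseq R &
  forall R', same_fcl R R' -> (ncross s R <= ncross s R')%N].

Lemma goodC s R : good s R -> good s (~: R).
Proof.
case=> fl ts nR mR; split; rewrite ?nonseqC // => R'.
by rewrite -{1}[R']setCK same_fclC ncrossC => /mR; rewrite ncrossC.
Qed.

Lemma good_catC C D R : good (C ++ D) R -> good (D ++ C) R.
Proof.
have mDC : C ++ D =i D ++ C by move=> P; rewrite !mem_cat orbC.
have dDC X : disp (D ++ C) X = disp (C ++ D) X by rewrite /disp !all_cat andbC.
have nDC X : ncross (D ++ C) X = ncross (C ++ D) X.
  by apply: eq_card => P; rewrite !inE mDC.
case=> fl ts nR mR; split=> //; first exact: flower_catC.
  move=> s' fs' lt_s' d' h; apply: (ts s' fs').
  - by rewrite size_cat addnC -size_cat.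
  - by move=> X /d'; rewrite dDC.
  - by move=> X kX; rewrite -dDC; apply: h.
by move=> R' /mR; rewrite !nDC.
Qed.

(** The form in which tightness is applied. The petal [b] fixes a side: after passing to
    complements, only separations [X] containing [b] have to be matched. *)
Lemma tight_merge C D b R : good (C ++ D) R -> (1 < size C)%N -> b \in C ++ D ->
  ~ (forall X, nonseq X -> b \subset X -> disp (C ++ D) X ->
     exists2 X', disp (U C :: D) X' & same_fcl X X').
Proof.
case=> fl ts _ _ ltC pb h; apply: (ts (U C :: D)).
- by apply: flower_merge fl _; case: (C) ltC.
- by rewrite size_cat /=; lia.
- by move=> X; apply: disp_merge.
move=> X kX dX; case/orP: (allP dX b pb) => sb; first exact: h (kS_nonseq kX) sb dX.
have [||Y dY sY] := h (~: X) _ sb; first exact/kS_nonseq/kS_C.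
  by rewrite dispC.
by exists (~: Y); rewrite ?dispC // -same_fclC setCK.
Qed.

(** [R :|: X] is equivalent to [R], crosses no new petal and crosses none inside [X]. By minimality
    [R] crosses none inside [X] either, and such a petal cannot lie in [~: R], being strong while
    [X :&: ~: R] is weak. *)
Lemma absorb_displayed s R X : good s R -> disp s X -> ks (R :|: X) ->
  weak (X :&: ~: R) -> X \subset R.
Proof.
case=> fl ts nR mR dX kRX wX.
have sRX : R \subset R :|: X by apply: subsetUl.
have e : same_fcl R (R :|: X).
  by apply: same_fcl_step => //; apply: weakS wX; set_decide.
have cr P : P \in s -> crossed (R :|: X) P -> crossed R P && ~~ (P \subset X).
  move=> Ps; rewrite /crossed !negb_or => /andP[n1 n2].
  have nPX : ~~ (P \subset X) by apply: contra n1; move=> h; set_decide.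
  rewrite nPX andbT; apply/andP; split; first by apply: contra n1 => h; set_decide.
  have /orP[h|sC] := allP dX P Ps; first by rewrite h in nPX.
  by apply: contra n2 => h; set_decide.
have nocr P : P \in s -> P \subset X -> ~~ crossed R P.
  move=> Ps sPX; apply/negP => crP; have := mR _ e; rewrite leqNgt => /negP; apply.
  apply: proper_card; rewrite properE; apply/andP; split.
    by apply/subsetP => Q; rewrite !inE => /andP[Qs /(cr Q Qs)/andP[-> _]]; rewrite Qs.
  apply/subsetPn; exists P; rewrite !inE ?Ps //=.
  by apply/negP => /(cr P Ps); rewrite sPX andbF.
apply/subsetP => x xX; have [cov _ _ _ _] := fl.
have /mem_U[P Ps xP] : x \in U s by rewrite cov.
have sPX : P \subset X.
  by case/orP: (allP dX P Ps) => // /subsetP/(_ x xP); rewrite inE xX.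
have := nocr P Ps sPX; rewrite negbK => /orP[/subsetP-> //|sPC].
case/negP: (flower_strong fl Ps); apply: weakS wX.
by rewrite subsetI sPX.
Qed.

Lemma absorb_arc s R X : good s R -> disp s X -> ks X ->
  strong (X :&: R) -> weak (X :&: ~: R) -> X \subset R.
Proof.
move=> g dX kX sXR wX; apply: (absorb_displayed g dX _ wX).
have [_ _ /andP[/andP[/and3P[kR _ sCR] _] _] _] := g.
by apply: ksU; rewrite // setIC.
Qed.

Lemma absorb_arcC s R X : good s R -> disp s X -> ks X ->
  strong (X :&: ~: R) -> weak (X :&: R) -> X \subset ~: R.
Proof.
move=> gR dX kX sX wX; apply: (absorb_arc (goodC gR) dX kX sX).
by rewrite setCK.
Qed.

(* If it failed, merging [P] and [Q] would contradict tightness. *)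
Lemma not_loose P Q s R V : good (P :: Q :: s) R -> V \subset P -> ks (Q :|: V) ->
  weak V -> ~ weak (P :\: V).
Proof.
move=> g sVP kQV wV wPV; have [fl _ _ _] := g.
have pQ : Q \in P :: Q :: s by rewrite !inE eqxx orbT.
have PQ : ks (P :|: Q).
  by have := flower_ks (C := [:: P; Q]) (D := s) fl isT; rewrite big_cons big_seq1.
apply: (tight_merge (C := [:: P; Q]) (D := s) g isT pQ) => X nX sQX dX.
have UPQ : U [:: P; Q] = P :|: Q by rewrite big_cons big_seq1.
have dXs : disp s X by case/and3P: dX.
have /and3P[kX sX sCX] : strong_ksep X by case/andP: nX => /andP[].
have [sPX|sPC] := orP (allP dX P (mem_head _ _)).
  exists X; last by apply: same_fcl_refl; apply/and3P.
  by rewrite /= UPQ subUset sPX sQX.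
have QX : strong (X :&: Q) by rewrite (setIidPr sQX); apply: flower_strong fl pQ.
exists (X :|: P).
  have sPQ : P :|: Q \subset X :|: P by set_decide.
  rewrite /= UPQ sPQ.
  apply/allP => Y Ys; case/orP: (allP dXs Y Ys) => [sY|sY].
    by rewrite subsetU ?sY ?orbT.
  apply/orP; right; case: (fl) => _ un dis _ _.
  have YP : P :&: Y = set0.
    apply: dis; rewrite ?mem_head // ?in_cons ?Ys ?orbT //.
    by apply: contraTneq un => ->; rewrite /= in_cons Ys orbT.
  by set_decide.
apply: (@same_fcl_step2 X (X :|: V)) => //; try set_decide.
- have -> : X :|: V = X :|: (Q :|: V) by set_decide.
  by apply: ksU => //; apply: strongS QX; set_decide.
- have -> : X :|: P = X :|: (P :|: Q) by set_decide.
  by apply: ksU => //; apply: strongS QX; set_decide.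
- by apply: weakS wV; set_decide.
- by apply: weakS wPV; set_decide.
Qed.

(** * Petals cut into two weak parts *)

Definition split_weak R X := weak (X :&: R) && weak (X :&: ~: R).

Lemma split_weakC R X : split_weak (~: R) X = split_weak R X.
Proof. by rewrite /split_weak setCK andbC. Qed.

Lemma split_weakS R X Y : X \subset Y -> split_weak R Y -> split_weak R X.
Proof. by move=> sXY /andP[w1 w2]; rewrite /split_weak !(weakS (setSI _ sXY)). Qed.

(** Otherwise uncrossing shows in turn that [U C :|: R], [U C :|: P :&: R] and [Q :|: P :&: R] are
    [k]-separating, with [Q] the first petal of [C]; then [P] can pass into [Q] in two weak steps,
    against [not_loose]. *)
Lemma tight_arc P C D R : good (P :: C ++ D) R -> C != [::] -> split_weak R P ->
  strong (U C :&: R) -> ~ strong (U D :&: ~: R).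
Proof.
case: C => // Q C g _ /andP[wPR wPC] sCR sDC; have [fl _ nR _] := g.
have /and3P[kR sR sCR'] : strong_ksep R by case/andP: nR => /andP[].
have kC : ks (U (Q :: C)).
  by have [] := @flower_mid [:: P] (Q :: C) D fl isT.
have kPC : ks (P :|: U (Q :: C)).
  by have := flower_ks (C := P :: Q :: C) fl isT; rewrite big_cons.
have kPQ : ks (P :|: Q).
  by have := flower_ks (C := [:: P; Q]) fl isT; rewrite big_cons big_seq1.
have complP := flower_UC (C := [:: P]) fl.
have complD := flower_UC (C := P :: Q :: C) (D := D) fl.
have sQC : Q \subset U (Q :: C) by apply/sub_U/mem_head.
rewrite big_seq1 big_cat /= in complP; rewrite big_cons /= in complD.
have kCR : ks (U (Q :: C) :|: R).
  by apply: ksU => //; apply: strongS sDC; set_decide.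
have kCP : ks (U (Q :: C) :|: P :&: R).
  have -> : U (Q :: C) :|: P :&: R = (P :|: U (Q :: C)) :&: (U (Q :: C) :|: R).
    by set_decide.
  apply: ksI => //; first by apply: strongS sCR; set_decide.
  by apply: strongS sDC; set_decide.
have kQP : ks (Q :|: P :&: R).
  have -> : Q :|: P :&: R = (U (Q :: C) :|: P :&: R) :&: (P :|: Q) by set_decide.
  apply: ksI => //; first by apply: strongS sCR; set_decide.
  by apply: strongS sDC; set_decide.
apply: (not_loose g (subsetIl P R) kQP wPR).
by apply: weakS wPC; set_decide.
Qed.

(** If [U s :&: R] is weak, then either four weak sets cover [E], or absorption puts [U s] inside
    [~: R], so that [R] lies in [P] and is weak. *)
Lemma split_weak_rest P s R : good (P :: s) R -> split_weak R P -> strong (U s :&: R).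
Proof.
move=> g /andP[wPR wPC]; apply/negP => wsR; have [fl _ nR _] := g.
have compl := flower_UC (C := [:: P]) (D := s) fl; rewrite big_seq1 in compl.
have [wsC|ssC] := boolP (weak (U s :&: ~: R)).
  have := @weak_cover [:: P :&: R; P :&: ~: R; U s :&: R; U s :&: ~: R] isT.
  rewrite /= wPR wPC wsR wsC => /(_ isT)/eqP; apply.
  by rewrite !big_cons big_nil /=; set_decide.
have ns : s != [::].
  by apply: contraNneq ssC => ->; rewrite big_nil set0I; apply: weak0 wPR.
have sC : U s \subset ~: R.
  apply: absorb_arcC g _ _ ssC wsR; last exact: (@flower_ksr [:: P] s fl ns).
  by rewrite -dispC compl setCK; have := disp_U (C := [:: P]) fl; rewrite big_seq1.
have /and3P[_ sR _] : strong_ksep R by case/andP: nR => /andP[].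
by case/negP: sR; apply: weakS wPR; set_decide.
Qed.

Lemma split_weak_side P C D R : good (P :: C ++ D) R -> C != [::] -> D != [::] ->
  split_weak R P -> weak (U C :&: R) -> ~ weak (U D :&: R).
Proof.
move=> g nC nD wP wC wD; have [fl _ _ _] := g; have /andP[wPR wPC] := wP.
have complP := flower_UC (C := [:: P]) fl.
rewrite big_seq1 big_cat /= in complP.
have restR : U C :|: U D = U (C ++ D) by rewrite big_cat.
have [kC dC] := flower_mid (C1 := [:: P]) fl nC.
have [kD dD] : ks (U D) /\ disp (P :: C ++ D) (U D).
  have := @flower_mid (P :: C) D [::]; rewrite cats0 /=; exact.
have /negP := split_weak_rest g wP; apply; rewrite -restR setIUl.
have [wCC|sCC] := boolP (weak (U C :&: ~: R)); last first.
  have := absorb_arcC g dC kC sCC wC => sub.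
  by apply: weakS wD; set_decide.
have [wDC|sDC] := boolP (weak (U D :&: ~: R)); last first.
  have := absorb_arcC g dD kD sDC wD => sub.
  by apply: weakS wC; set_decide.
have := @weak_cover [:: P :&: R; P :&: ~: R; U C :&: R; U C :&: ~: R;
  U D :&: R; U D :&: ~: R] isT.
rewrite /= wPR wPC wC wCC wD wDC => /(_ isT)/eqP; case.
by rewrite !big_cons big_nil /=; set_decide.
Qed.

(** If [U C :&: R] is strong, [tight_arc] makes [U D :&: ~: R] weak, so [U C :&: ~: R] is strong by
    [split_weak_side], and [tight_arc] for [~: R] makes [U D :&: R] weak. If it is weak, the same
    reasoning shows that [C] is split. *)
Lemma split_weak_arcs P C D R : good (P :: C ++ D) R -> C != [::] -> D != [::] ->
  split_weak R P -> split_weak R (U C) || split_weak R (U D).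
Proof.
move=> g nC nD wP; rewrite /split_weak.
have gC := goodC g; have wPC : split_weak (~: R) P by rewrite split_weakC.
have := tight_arc g nC wP; have := tight_arc gC nC wPC; rewrite setCK.
have := split_weak_side g nC nD wP; have := split_weak_side gC nC nD wPC.
rewrite /Defs.strong; case: (weak (U C :&: R)); case: (weak (U C :&: ~: R));
  case: (weak (U D :&: R)); case: (weak (U D :&: ~: R)) => //=; intuition.
Qed.

(** Lengthen [C] petal by petal while it stays split; at the petal [Q] where this fails,
    [split_weak_arcs] says that the rest [D] is split. [C] cannot exhaust [s], by
    [split_weak_rest]. *)
Lemma split_weak_center P s R : good (P :: s) R -> split_weak R P ->
  exists C Q D, [/\ s = C ++ Q :: D, split_weak R (U C) & split_weak R (U D)].
Proof.
move=> g wP; have /andP[wPR wPC] := wP.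
have w0 : split_weak R (U [::]).
  by rewrite /split_weak big_nil !set0I (weak0 wPR).
have claim D : forall C, s = C ++ D -> split_weak R (U C) ->
    exists C Q D, [/\ s = C ++ Q :: D, split_weak R (U C) & split_weak R (U D)].
  elim: D => [|Q D IH] C Es wC.
    have /negP := split_weak_rest g wP; case.
    by rewrite Es cats0; case/andP: wC.
  have [D0|nD] := eqVneq D [::].
    by exists C, Q, [::]; rewrite Es D0.
  have g' : good (P :: rcons C Q ++ D) R by rewrite cat_rcons -Es.
  have nCQ : rcons C Q != [::] by rewrite -size_eq0 size_rcons.
  case/orP: (split_weak_arcs g' nCQ nD wP) => [wCQ|wD].
  - by apply: (IH (rcons C Q)) => //; rewrite Es cat_rcons.
  - by exists C, Q, D.
exact: claim s [::] erefl w0.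
Qed.

(** Otherwise absorption puts [Q], and then its unions with [C] and with [D], inside [R],
    contradicting [split_weak_rest] for [~: R]. *)
Lemma center_half P C Q D R : good (P :: C ++ Q :: D) R -> split_weak R P ->
  split_weak R (U C) -> split_weak R (U D) -> strong (Q :&: R) -> strong (Q :&: ~: R).
Proof.
move=> g wP wC wD sQR; apply/negP => wQC; have [fl _ _ _] := g.
have [kQ dQ] := @flower_mid (P :: C) [:: Q] D fl isT; rewrite big_seq1 in kQ dQ.
have sQ := absorb_arc g dQ kQ sQR wQC.
have [kD dD] : ks (U (Q :: D)) /\ disp (P :: C ++ Q :: D) (U (Q :: D)).
  have := @flower_mid (P :: C) (Q :: D) [::]; rewrite cats0 /=; exact.
have fl' := fl; rewrite -cat_rcons in fl'.
have nC : rcons C Q != [::] by rewrite -size_eq0 size_rcons.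
have [kC dC] := flower_mid (C1 := [:: P]) fl' nC.
rewrite /= cat_rcons -cats1 big_cat big_seq1 /= in kC dC.
rewrite big_cons /= in kD dD.
have /andP[_ wCC] := wC; have /andP[_ wDC] := wD.
have sD := @absorb_arc _ _ _ g dD kD _ _.
have sC := @absorb_arc _ _ _ g dC kC _ _.
have {}sD : U D \subset R.
  apply: subset_trans (subsetUr Q _) (sD _ _); first by apply: strongS sQR; set_decide.
  by apply: weakS wDC; set_decide.
have {}sC : U C \subset R.
  apply: subset_trans (subsetUl _ Q) (sC _ _); first by apply: strongS sQR; set_decide.
  by apply: weakS wCC; set_decide.
have /negP := split_weak_rest (goodC g) (etrans (split_weakC R P) wP); apply.
by rewrite big_cat big_cons /=; apply: weakS wDC; set_decide.
Qed.

Lemma center_strong P C Q D R : good (P :: C ++ Q :: D) R -> split_weak R P ->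
  split_weak R (U C) -> split_weak R (U D) -> strong (Q :&: R) /\ strong (Q :&: ~: R).
Proof.
move=> g wP wC wD; have [fl _ _ _] := g.
have h1 := center_half g wP wC wD.
have := center_half (goodC g); rewrite !split_weakC setCK => /(_ wP wC wD) h2.
have [wQR|sQR] := boolP (weak (Q :&: R)); last by split=> //; apply: h1.
have [wQC|sQC] := boolP (weak (Q :&: ~: R)); last by split=> //; apply: h2.
have [cov _ _ _ _] := fl; rewrite big_cons big_cat big_cons /= in cov.
have [/andP[w1 w2] /andP[w3 w4] /andP[w5 w6]] := And3 wP wC wD.
(* The two halves of [P], [U C], [Q] and [U D] are eight weak sets covering [E], exactly what (RT3)
   forbids. *)
have := @weak_cover [:: P :&: R; P :&: ~: R; U C :&: R; U C :&: ~: R;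
  Q :&: R; Q :&: ~: R; U D :&: R; U D :&: ~: R] isT.
rewrite /= w1 w2 w3 w4 w5 w6 wQR wQC => /(_ isT)/eqP; case.
by rewrite !big_cons big_nil /=; set_decide.
Qed.

(** All of [t] can be merged into one petal. As [Q] is not split, [split_weak_arcs] at each of its
    two neighbours shows that [t] without that neighbour is split, which forces every relevant
    separation to be equivalent to [Q]. *)
Lemma center_contra Q t R : good (Q :: t) R -> t != [::] ->
  strong (Q :&: R) -> strong (Q :&: ~: R) -> ~ {in t, forall P, split_weak R P}.
Proof.
move=> g nt sQR sQC wt; have [fl _ nR _] := g.
have /and3P[kR sR sCR] : strong_ksep R by case/andP: nR => /andP[].
have [_ sQ kQ] := flower_petal fl (mem_head _ _).
have compl := flower_UC (C := [:: Q]) fl; rewrite big_seq1 in compl.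
have kCR : ks (~: R) by rewrite ksC.
case: t nt fl g wt compl => // P1 M _ fl g wt compl.
have wP1 : split_weak R P1 by apply: wt (mem_head _ _).
case/lastP: M fl g wt compl => [|B P3] fl g wt compl.
  (* With two petals, [Q :|: P1 :&: R] equals [Q :|: R], so [P1] passes into [Q] in two weak
     steps. *)
  rewrite big_seq1 in compl; have /andP[wR wC] := wP1.
  apply: (not_loose (good_catC (C := [:: Q]) g) (subsetIl P1 R) _ wR).
    have -> : Q :|: P1 :&: R = Q :|: R by set_decide.
    apply: ksU => //; rewrite -compl; apply: flower_strong fl _.
    by rewrite !inE eqxx orbT.
  by apply: weakS wC; set_decide.
have gQ := good_catC (C := [:: Q]) g; rewrite /= in gQ.
have UQ : U [:: Q] = Q by rewrite big_seq1.
have nwQ : split_weak R Q = false by rewrite /split_weak (negPf sQR).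
have nM : rcons B P3 != [::] by rewrite -size_eq0 size_rcons.
have wM : split_weak R (U (rcons B P3)).
  by have := split_weak_arcs gQ nM isT wP1; rewrite UQ nwQ orbF.
have wM' : split_weak R (U (P1 :: B)).
  have g3 : good (P3 :: [:: Q] ++ P1 :: B) R.
    by have := g; rewrite -rcons_cons -cats1 -cat_cons => /good_catC.
  have wP3 : split_weak R P3 by apply: wt; rewrite inE mem_rcons mem_head orbT.
  by have := split_weak_arcs g3 isT isT wP3; rewrite UQ nwQ.
have wB : split_weak R (U B).
  by apply: split_weakS wM'; rewrite big_cons subsetUr.
have eqM : U (P1 :: rcons B P3) = P1 :|: U (rcons B P3) by rewrite big_cons.
have eqM' : U (P1 :: rcons B P3) = U (P1 :: B) :|: P3.
  by rewrite -rcons_cons -cats1 big_cat big_seq1.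
have eqB : U (P1 :: B) = P1 :|: U B by rewrite big_cons.
have pQ : Q \in (P1 :: rcons B P3) ++ [:: Q] by rewrite mem_cat mem_head orbT.
have lt_t : (1 < size (P1 :: rcons B P3))%N by rewrite /= size_rcons.
apply: (tight_merge (C := P1 :: rcons B P3) (D := [:: Q]) gQ lt_t pQ) => X nX sQX dX.
have /and3P[kX sX sCX] : strong_ksep X by case/andP: nX => /andP[].
(* Otherwise [X] could be enlarged by the weak set [~: X :&: R], leaving only the weak set
   [~: X :&: ~: R] as complement. *)
have nwCX : ~~ split_weak R (~: X).
  apply/negP => /andP[wXR wXC].
  have kXR : ks (X :|: R).
    apply: ksU => //; first by apply: strongS sQR; set_decide.
  have /negP : strong (~: (X :|: R)).
    apply: nonseq_step_strongC nX _ kXR _; first by apply: subsetUl.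
    by apply: weakS wXR; set_decide.
  by apply; apply: weakS wXC; set_decide.
(* If [P] were in [X], then [~: X] would lie in the split set [Z]. Hence both neighbours of [Q] lie
   in [~: X], and [~: X] differs from [~: Q] only within [U B]. *)
have out P Z : P \in P1 :: rcons B P3 -> U (P1 :: rcons B P3) \subset P :|: Z ->
    split_weak R Z -> P \subset ~: X.
  move=> Pt sZ wZ; have := allP dX P; rewrite mem_cat Pt => /(_ isT)/orP[sPX|//].
  by case/negP: nwCX; apply: split_weakS wZ; set_decide.
have oP1 : P1 \subset ~: X.
  by apply: out (mem_head _ _) _ wM; rewrite eqM.
have oP3 : P3 \subset ~: X.
  apply: out _ _ wM'; first by rewrite inE mem_rcons mem_head orbT.
  by rewrite eqM' setUC.
pose A := ~: Q.
have kA : ks A by rewrite ksC.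
(* [~: X] grows to [~: Q] in two weak steps, first inside [Z] and then outside; [Z] is whichever of
   [R] and [~: R] meets [~: X] in a strong set. *)
have sub Z : ks (Q :|: ~: Z) -> strong (~: X :&: Z) ->
    weak (U B :&: Z) -> weak (U B :&: ~: Z) -> same_fcl (~: X) A.
  move=> kQZ sXZ wBZ wBC.
  have kAZ : ks (A :&: Z) by rewrite -ksC setCI setCK.
  have kY : ks (~: X :|: A :&: Z).
    apply: ksU; rewrite ?ksC ?setCK //.
    by apply: strongS sXZ; rewrite /A; set_decide.
  apply: (@same_fcl_step2 _ (~: X :|: A :&: Z)) => //; rewrite ?nonseqC //.
  - exact: subsetUl.
  - by rewrite /A; set_decide.
  - by apply: weakS wBZ; rewrite /A; set_decide.
  - by apply: weakS wBC; rewrite /A; set_decide.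
have sCQ : strong (~: Q).
  by apply: strongS sCX; rewrite setCS.
have [wBR wBC] := andP wB.
have eXA : same_fcl (~: X) A.
  have [wXR|sXR] := boolP (weak (~: X :&: R)).
    apply: (sub (~: R)); rewrite ?setCK //.
      by apply: ksU.
    by apply: contra nwCX => wXC; rewrite /split_weak wXR.
  by apply: (sub R) => //; apply: ksU; rewrite // ?ksC.
exists Q; last by rewrite -same_fclC.
by rewrite /= compl !subxx orbT.
Qed.

Lemma no_split_weak s R P : good s R -> P \in s -> ~ split_weak R P.
Proof.
move=> g /rot_to[i s' Es] wP.
have {}g : good (P :: s') R by rewrite -Es; apply: good_catC; rewrite cat_take_drop.
have [C [Q [D [Es' wC wD]]]] := split_weak_center g wP.
rewrite {}Es' in g; have [sQR sQC] := center_strong g wP wC wD.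
have g' : good (Q :: D ++ P :: C) R := good_catC (C := P :: C) g.
apply: center_contra g' _ sQR sQC _; first by rewrite -size_eq0 size_cat addnS.
move=> X; rewrite mem_cat in_cons => /or3P[/sub_U sX|/eqP-> //|/sub_U sX].
  exact: split_weakS sX wD.
exact: split_weakS sX wC.
Qed.

(** * Splitting the crossed petals and applying maximality *)

Lemma disp_petal s P : flower s -> P \in s -> disp s P.
Proof.
move=> [_ _ dis _ _] Ps; apply/allP => Q Qs.
have [->|nQP] := eqVneq Q P; first by rewrite subxx.
by apply/orP; right; have d0 := dis _ _ Qs Ps nQP; set_decide.
Qed.

Lemma petal_strong s R P : good s R -> P \in s -> P :&: R != set0 -> strong (P :&: R).
Proof.
move=> g Ps nPR; have [fl _ _ _] := g; have [_ _ kP] := flower_petal fl Ps.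
apply/negP => wPR; have [wPC|sPC] := boolP (weak (P :&: ~: R)).
  by apply: no_split_weak g Ps _; apply/andP.
have sPCR := absorb_arcC g (disp_petal fl Ps) kP sPC wPR.
by move/eqP: nPR; apply; set_decide.
Qed.

Lemma T_equiv_trans X Y Z :
  T_equiv lam k T X Y -> T_equiv lam k T Y Z -> T_equiv lam k T X Z.
Proof.
case=> sX _ e1 [_ sZ e2]; split=> //.
by case: e1 e2 => -[-> ->] [[-> ->]|[-> ->]]; auto.
Qed.

Lemma T_equiv_refl X : strong_ksep X -> T_equiv lam k T X X.
Proof. by move=> sX; split=> //; left. Qed.

Lemma flower_nil s : flower s -> s != [::] -> ~ flower [::].
Proof.
case: s => // P s fl _ [cov _ _ _ _].
have [/set0Pn[x _] _ _] := flower_petal fl (mem_head _ _).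
by have := in_setT x; rewrite -cov big_nil inE.
Qed.

Lemma kS_strong_ksep X : kS X -> strong_ksep X.
Proof. by case/kS_nonseq/andP=> /andP[]. Qed.

Lemma S_tight_tight s : flower s -> s != [::] -> S_tight lam k T S s -> tight s.
Proof.
move=> fl ns ts s' fl' lt_s' d' h; apply: ts; exists s'; split=> //.
  by apply/flowerP => //; apply/eqP => s0; apply: flower_nil fl ns _; rewrite -s0.
split=> X kX.
  move/(dispE _ fl) => dX; have [X' dX' eX] := h X kX dX; exists X'; split.
  - exact: same_fcl_kS kX eX.
  - exact/dispE.
  - exact: same_fcl_equiv.
move/(dispE _ fl')/d' => dX; exists X; split=> //; first exact/dispE.
exact/T_equiv_refl/kS_strong_ksep.
Qed.

Lemma kS_conforms s R : k_flower lam k T s -> S_tight lam k T S s ->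
  S_maximal lam k T S s -> kS R -> conforms lam k T s R.
Proof.
move=> kfl ts mx kR; have skR := kS_strong_ksep kR; split=> //.
have [s0|ns] := eqVneq s [::].
  (* An empty flower covers [E] only if [E] is empty, and then [R] is the empty union. *)
  exists R; split; first exact: T_equiv_refl.
  left; exists xpred0; rewrite big_pred0_eq.
  case: kfl; rewrite s0 U_nth big_nil => cov *.
  by set_decide.
have fl : flower s by apply/flowerP.
case: (@arg_minnP _ R (same_fcl R) (ncross s) (same_fcl_refl skR)) => R0 eR0 minR0.
have kR0 := same_fcl_kS kR eR0; have skR0 := kS_strong_ksep kR0.
have g : good s R0.
  split=> //; [exact: S_tight_tight | exact: kS_nonseq | move=> R' eR'].
  by apply: minR0; apply: same_fcl_trans eR0 eR'.
have [/hasP[P Ps inP]|/hasPn nin] :=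
    boolP (has (fun P => (R0 \subset P) || (~: R0 \subset P)) s).
  exists R0; split; first exact: same_fcl_equiv.
  right; exists (index P s); rewrite index_mem /petal nth_index //.
  by split=> //; apply/orP.
have hR : {in s, forall P, P :&: R0 != set0 -> strong (P :&: R0)}.
  by move=> P; apply: petal_strong g.
have hC : {in s, forall P, P :&: ~: R0 != set0 -> strong (P :&: ~: R0)}.
  by move=> P; apply: petal_strong (goodC g).
have hsub : {in s, forall P, ~~ (R0 \subset P) && ~~ (~: R0 \subset P)}.
  by move=> P /nin; rewrite negb_or.
have [s2 [fl2 ns2 d2 dR2]] := refine_displaying fl ns skR0 hR hC hsub.
have kfl2 : k_flower lam k T s2 by apply/flowerP.
have le_s_s2 : flower_le lam k T S s s2.
  move=> X kX dX; exists X; split=> //; last exact/T_equiv_refl/kS_strong_ksep.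
  by apply/dispE => //; apply/d2/(dispE _ fl).
have dR0 : displays s2 R0 by apply/dispE.
(* The refinement [s2] displays all that [s] does, so by maximality [s] displays an equivalent of
   [R0]. *)
have [X [kX dX eX]] := mx s2 kfl2 le_s_s2 R0 kR0 dR0.
exists X; split; last by left.
exact: T_equiv_trans (same_fcl_equiv eR0) eX.
Qed.

End Tangle.

Theorem theorem5p10 (E : finType) (lam : {set E} -> int) (k : int)
    (T S : {set {set E}}) (Phi : seq {set E}) :
  connectivity_system lam ->
  robust_tangle lam k T ->
  admissible_S lam k T S ->
  tree_compatible lam k T S ->
  k_flower lam k T Phi ->
  S_tight lam k T S Phi ->
  S_maximal lam k T S Phi ->
  forall R : {set E}, kS_sep lam k S R -> conforms lam k T Phi R.
Proof.
move=> lamP tangleT admS treeS flPhi tPhi mPhi R.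
exact: (kS_conforms lamP tangleT admS treeS flPhi tPhi mPhi).
Qed.
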